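(* Let $k\in\mathbb{N}$, let $0\leq n_1<\dots<n_k$ be integers, let $a,b\in\mathbb{R}$ with $a<b$ and let $\lambda_j:=\frac{2}{b-a}\tau_{n_j}$ for $j\in\{1,\dots,k\}$. Define $(c_0,c_1,\dots,c_{2k})\in\mathbb{R}^{2k+1}$ by the equality $$\big(z^2+\lambda_1^2\big)\cdots\big(z^2+\lambda_k^2\big)=c_{2k}z^{2k}+\dots+c_1z+c_0\qquad(z\in\mathbb{C}).$$ Then, for all $f\in\mathscr{C}^{2k}_{\mathbb{K}}([a,b])$, $$\frac{f(a)+f(b)}{2}-\frac{1}{b-a}\int_a^bf(x)\,dx=\int_a^bD_c(f)(t)\cdot g(t)\,dt,$$ where $$g(t):=\begin{cases}\displaystyle\sum_{j=1}^k\frac{\sin(\lambda_j(b-t)/2)\sin(\lambda_j(t-a)/2)}{\lambda_jQ_j(\lambda_j)\sin(\lambda_j(b-a)/2)}&\text{if }n_1>0,\\[4mm]\displaystyle\frac{(b-t)(t-a)}{2Q_1(0)(b-a)}+\sum_{j=2}^k\frac{\sin(\lambda_j(b-t)/2)\sin(\lambda_j(t-a)/2)}{\lambda_jQ_j(\lambda_j)\sin(\lambda_j(b-a)/2)}&\text{if }n_1=0,\end{cases}$$ and $Q_j(z):=\prod_{\ell\in\{1,\dots,k\}\setminus\{j\}}(\lambda_\ell^2-z^2)$ for $j\in\{1,\dots,k\}$.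
   Context: $\mathbb{K}$ is $\mathbb{R}$ or $\mathbb{C}$, and $\mathscr{C}^{2k}_{\mathbb{K}}([a,b])$ is the space of $2k$ times continuously differentiable $\mathbb{K}$-valued functions on $[a,b]$. For an integer $m$, $\tau_m$ denotes the unique fixed point of the tangent function (i.e. the unique $v$ with $\tan v=v$) in the open interval $\big((m-\frac12)\pi,(m+\frac12)\pi\big)$; in particular $\tau_0=0$. The differential operator $D_c$ is defined by $D_c(f):=c_{2k}f^{(2k)}+\dots+c_1f'+c_0f$. Empty products equal $1$ and empty sums equal $0$. *)

(* Defs.v *)
From Stdlib Require Import Reals ZArith List Lra Lia.
From Coquelicot Require Import Coquelicot.

Open Scope R_scope.

Inductive scalar_field := RealField | ComplexField.

(* The two fields are taken as normed spaces over R: differentiation with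
   respect to a real variable and multiplication by real numbers only use
   this structure. *)
Definition scalars (K : scalar_field) : CompleteNormedModule R_AbsRing :=
  match K with
  | RealField => R_CompleteNormedModule
  | ComplexField => C_R_CompleteNormedModule
  end.

Section DifferentiationOnInterval.

Context {V : CompleteNormedModule R_AbsRing}.
Variables a b : R.

(* [is_derive] with the neighbourhoods of [x] intersected with [a, b]; the
   derivative is thus one-sided at [a] and at [b], and the values of [f]
   outside [a, b] play no role. *)
Definition is_derive_on (f : R -> V) (x : R) (l : V) : Prop :=
  filterdiff f (within (fun y => a <= y <= b) (locally x))
    (fun y => scal y l).

Definition ex_derive_on (f : R -> V) (x : R) : Prop :=
  exists l, is_derive_on f x l.

Definition Derive_on (f : R -> V) (x : R) : V := iota (is_derive_on f x).

Fixpoint Derive_n_on (f : R -> V) (m : nat) : R -> V :=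
  match m with
  | O => f
  | S m' => Derive_on (Derive_n_on f m')
  end.

Definition C_n_on (m : nat) (f : R -> V) : Prop :=
  (forall (i : nat) (x : R), (i < m)%nat -> a <= x <= b ->
     ex_derive_on (Derive_n_on f i) x) /\
  continuous_on (fun x => a <= x <= b) (Derive_n_on f m).

(* D_c, where c_0, ..., c_d are the coefficients of a polynomial of degree
   at most d. *)
Definition diff_op (d : nat) (c : nat -> R) (f : R -> V) (t : R) : V :=
  sum_n (fun i => scal (c i) (Derive_n_on f i t)) d.

End DifferentiationOnInterval.

Definition is_tan_fixpoint (m : Z) (v : R) : Prop :=
  (IZR m - 1 / 2) * PI < v < (IZR m + 1 / 2) * PI /\ tan v = v.

Definition tau (m : Z) : R := iota (is_tan_fixpoint m).

Definition lambda (a b : R) (n : nat -> Z) (j : nat) : R :=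
  2 / (b - a) * tau (n j).

Definition Q (k : nat) (lam : nat -> R) (j : nat) (z : R) : R :=
  fold_right Rmult 1
    (map (fun l => lam l ^ 2 - z ^ 2)
       (filter (fun l => negb (l =? j)%nat) (seq 1 k))).

Definition g_term (a b : R) (k : nat) (lam : nat -> R) (t : R) (j : nat) : R :=
  (sin (lam j * (b - t) / 2) * sin (lam j * (t - a) / 2)) /
  (lam j * Q k lam j (lam j) * sin (lam j * (b - a) / 2)).

Definition g (a b : R) (k : nat) (n : nat -> Z) (t : R) : R :=
  let lam := lambda a b n in
  if (0 <? n 1%nat)%Z then
    sum_n_m (g_term a b k lam t) 1 k
  else
    ((b - t) * (t - a)) / (2 * Q k lam 1 0 * (b - a)) +
    sum_n_m (g_term a b k lam t) 2 k.

Definition char_poly (k : nat) (lam : nat -> R) (z : C) : C :=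
  fold_right Cmult (RtoC 1)
    (map (fun j => Cplus (Cpow z 2) (RtoC (lam j ^ 2))) (seq 1 k)).

Lemma minus_minus_l {G : AbelianGroup} (d p q : G) :
  minus (minus d p) (minus d q) = minus q p.
Proof.
rewrite (minus_trans d q p), <- (opp_minus d q), plus_comm. reflexivity.
Qed.

Lemma minus_eq_zero_inv {G : AbelianGroup} (p q : G) :
  minus p q = zero -> p = q.
Proof.
intros E. apply (plus_reg_r (opp q)). rewrite plus_opp_r. exact E.
Qed.

Lemma is_derive_on_unique {V : CompleteNormedModule R_AbsRing} (a b : R)
  (f : R -> V) (x : R) (l : V) :
  a < b -> a <= x <= b -> is_derive_on a b f x l -> Derive_on a b f x = l.
Proof.
intros ab xab Hl.
assert (Hx : forall P : R -> Prop, locally x P ->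
  within (fun y => a <= y <= b) (locally x) P).
{ intros P HP. apply filter_imp with (2 := HP). now intros y Hy _. }
apply iota_unique; [|exact Hl].
intros l' Hl'.
destruct Hl as [_ Hl]. specialize (Hl x Hx).
destruct Hl' as [_ Hl']. specialize (Hl' x Hx).
assert (E : minus l' l = zero).
{ apply (norm_eq_zero (K := R_AbsRing) (V := V)).
  apply Rle_antisym; [|apply norm_ge_0].
  apply le_epsilon. intros eps Heps. rewrite Rplus_0_l.
  assert (He2 : 0 < eps / 2) by lra.
  specialize (Hl (mkposreal _ He2)). specialize (Hl' (mkposreal _ He2)).
  assert (HA := filter_and _ _ Hl Hl').
  destruct HA as [d Hd].
  assert (Hy : exists y, a <= y <= b /\ y <> x /\ Rabs (y - x) < d).
  { assert (d0 := cond_pos d).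
    destruct (Rle_lt_dec b x) as [bx|xb].
    - exists (Rmax a (x - d / 2)). unfold Rmax, Rabs.
      destruct Rle_dec; destruct Rcase_abs; lra.
    - exists (Rmin b (x + d / 2)). unfold Rmin, Rabs.
      destruct Rle_dec; destruct Rcase_abs; lra. }
  destruct Hy as [y [yab [yx yd]]].
  destruct (Hd y yd yab) as [H1 H2].
  assert (yx0 : 0 < Rabs (y - x)) by (apply Rabs_pos_lt; lra).
  apply Rmult_le_reg_l with (1 := yx0).
  change (@norm R_AbsRing R_NormedModule (minus y x)) with (Rabs (y - x)) in H1, H2.
  simpl in H1, H2.
  assert (S1 : Rabs (y - x) * norm (minus l' l) <=
    norm (scal (y - x) (minus l' l))).
  { assert (SE : scal (/ (y - x)) (scal (y - x) (minus l' l)) = minus l' l).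
    { eapply eq_trans; [apply scal_assoc|].
      eapply eq_trans; [|apply (scal_one (V := V))].
      apply (f_equal (fun r => scal r (minus l' l))).
      apply Rinv_l. lra. }
    assert (S0 : norm (minus l' l) <=
      Rabs (/ (y - x)) * norm (scal (y - x) (minus l' l))).
    { eapply Rle_trans; [|apply (norm_scal (V := V) (/ (y - x)))].
      right. apply f_equal. symmetry. exact SE. }
    rewrite Rabs_inv in S0.
    apply (Rmult_le_compat_l _ _ _ (Rlt_le _ _ yx0)) in S0.
    rewrite <- Rmult_assoc, Rinv_r, Rmult_1_l in S0; [exact S0|lra]. }
  eapply Rle_trans; [exact S1|].
  assert (S2 : scal (y - x) (minus l' l) =
    minus (minus (minus (f y) (f x)) (scal (minus y x) l))
          (minus (minus (f y) (f x)) (scal (minus y x) l'))).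
  { eapply eq_trans; [apply (scal_minus_distr_l (V := V))|].
    symmetry. apply minus_minus_l. }
  rewrite S2.
  eapply Rle_trans; [apply (norm_triangle (V := V))|].
  eapply Rle_trans.
  { apply Rplus_le_compat; [exact H1|].
    rewrite (norm_opp (V := V)). exact H2. }
  lra. }
apply minus_eq_zero_inv. exact E.
Qed.

Lemma cos_neq_0_branch (m : Z) (v : R) :
  (IZR m - 1 / 2) * PI < v < (IZR m + 1 / 2) * PI -> cos v <> 0.
Proof.
intros Hv Hc.
destruct (cos_eq_0_0 _ Hc) as [p ->].
assert (HPI := PI_RGT_0).
assert (H1 : IZR m - 1 < IZR p) by nra.
assert (H2 : IZR p < IZR m) by nra.
apply lt_IZR in H2.
rewrite <- minus_IZR in H1. apply lt_IZR in H1. lia.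
Qed.

Lemma is_tan_fixpoint_ex (m : Z) : exists v, is_tan_fixpoint m v.
Proof.
assert (HPI := PI_RGT_0).
set (al := (IZR m - 1 / 2) * PI).
set (be := (IZR m + 1 / 2) * PI).
assert (Hbe : be = al + PI) by (unfold al, be; field).
assert (cal : cos al = 0).
{ replace al with (- (PI / 2 - IZR m * PI)) by (unfold al; field).
  rewrite cos_neg, cos_shift. apply sin_eq_0_1. now exists m. }
assert (cbe : cos be = 0) by (rewrite Hbe, neg_cos, cal; ring).
assert (sbe : sin be = - sin al) by (rewrite Hbe; apply neg_sin).
assert (sal := sin2_cos2 al). unfold Rsqr in sal. rewrite cal in sal.
set (h := fun v => sin v - v * cos v).
assert (hc : continuity h).
{ unfold h. apply continuity_minus; [apply continuity_sin|].
  apply continuity_mult; [|apply continuity_cos].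
  apply derivable_continuous, derivable_id. }
destruct (IVT_cor h al be hc) as [v [Hv Hhv]].
- lra.
- unfold h. rewrite cal, cbe, sbe. nra.
- unfold h in Hhv.
  assert (v <> al) by (intros ->; rewrite cal in Hhv; nra).
  assert (v <> be) by (intros ->; rewrite cbe, sbe in Hhv; nra).
  assert (Hv' : al < v < be) by lra.
  exists v. split; [exact Hv'|].
  assert (cv := cos_neq_0_branch m v Hv').
  unfold tan. replace (sin v) with (v * cos v) by lra. now field.
Qed.

Lemma is_tan_fixpoint_inj (m : Z) (u v : R) :
  is_tan_fixpoint m u -> is_tan_fixpoint m v -> u = v.
Proof.
assert (HPI := PI_RGT_0).
assert (W : forall u v, is_tan_fixpoint m u -> is_tan_fixpoint m v -> ~ u < v).
{ clear u v. intros u v [Hu Tu] [Hv Tv] uv.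
  assert (M : forall p q, u <= p -> p < q -> q <= v ->
    exists x, p < x < q /\ (tan q - q) - (tan p - p) = tan x ^ 2 * (q - p)).
  { intros p q Hp pq Hq.
    destruct (MVT_cor2 (fun x => tan x - x) (fun x => tan x ^ 2) p q pq)
      as [x [Hx1 Hx2]].
    - intros c Hc. apply is_derive_Reals.
      assert (cos c <> 0) by (apply (cos_neq_0_branch m); lra).
      unfold tan. auto_derive; [assumption|].
      now field.
    - exists x. split; [exact Hx2|]. exact Hx1. }
  set (w := (u + v) / 2).
  destruct (M u w) as [x [Hx Ex]]; try (unfold w; lra).
  destruct (M w v) as [y [Hy Ey]]; try (unfold w; lra).
  assert (Z : forall z, u < z < v -> tan z = 0 -> z = IZR m * PI).
  { intros z Hz Tz.
    assert (cz : cos z <> 0) by (apply (cos_neq_0_branch m); lra).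
    assert (sz : sin z = 0).
    { replace (sin z) with (tan z * cos z) by (unfold tan; now field).
      rewrite Tz. ring. }
    destruct (sin_eq_0_0 _ sz) as [p ->].
    assert (H1 : IZR m - 1 < IZR p) by nra.
    assert (H2 : IZR p < IZR m + 1) by nra.
    rewrite <- minus_IZR in H1. rewrite <- plus_IZR in H2.
    apply lt_IZR in H1, H2. replace p with m by lia. reflexivity. }
  assert (uw : 0 < w - u) by (unfold w; lra).
  assert (wv : 0 < v - w) by (unfold w; lra).
  assert (Px := pow2_ge_0 (tan x)). assert (Py := pow2_ge_0 (tan y)).
  assert (tx : tan x = 0) by (apply Rsqr_0_uniq; unfold Rsqr; nra).
  assert (ty : tan y = 0) by (apply Rsqr_0_uniq; unfold Rsqr; nra).
  apply Z in tx; [|lra]. apply Z in ty; [|lra]. lra. }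
intros Hu Hv.
destruct (Rtotal_order u v) as [H|[H|H]]; [|exact H|];
  [destruct (W u v) | destruct (W v u)]; assumption.
Qed.

Lemma tau_correct (m : Z) : is_tan_fixpoint m (tau m).
Proof.
destruct (is_tan_fixpoint_ex m) as [v Hv].
apply (@iota_correct R_AbsRing R_CompleteNormedModule (is_tan_fixpoint m)).
exists v. split; [exact Hv|].
intros w Hw. now apply (is_tan_fixpoint_inj m).
Qed.

(* Main.v *)
(* For u_j(t) = sin(lam_j (b-t)/2) sin(lam_j (t-a)/2) / (lam_j sin(lam_j (b-a)/2)),
   or (b-t)(t-a) / (2(b-a)) if lam_j = 0, the equation tan v = v satisfied by
   v = lam_j (b-a)/2 says that u_j'' + lam_j^2 u_j is the constant -1/(b-a), so
   two integrations by parts turn the integral of u_j (F'' + lam_j^2 F) into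
   T(F), the difference of the trapezoid value and the mean of F, which does not
   depend on j.  Factor D_c = (D^2 + lam_j^2) P_j(D^2) for each j.  Since g is
   the sum of the u_j / Q_j(lam_j), the right-hand side is T applied to the sum
   of the P_j(D^2) f / Q_j(lam_j), and this sum is f, by Lagrange interpolation
   of the constant 1 at the nodes -lam_j^2. *)
Require Import Defs.
From Stdlib Require Import Reals ZArith List FinFun Lra Lia.
From Coquelicot Require Import Coquelicot.

Open Scope R_scope.

(** * Polynomials as coefficient sequences *)

(** The coefficients of [(X + mu) p(X)]. A polynomial is an infinite sequence here, so degree bounds
    appear as vanishing conditions such as [p (S d) = 0]. *)
Definition mulX_add (mu : R) (p : nat -> R) (i : nat) : R :=
  mu * p i + match i with O => 0 | S i' => p i' end.

(** The sequence [v] lies in a module so that one identity serves both powers of a number and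
    iterated derivatives of [f]. The last term is what truncation at [S d] leaves over when [p] has
    degree above [d]. *)
Lemma sum_n_mulX_add {V : ModuleSpace R_Ring} (mu : R) (p : nat -> R)
  (v : nat -> V) (d : nat) :
  sum_n (fun i => scal (mulX_add mu p i) (v i)) (S d) =
  plus (sum_n (fun i => scal (p i) (plus (v (S i)) (scal mu (v i)))) d)
       (scal (mu * p (S d)) (v (S d))).
Proof.
assert (E : forall i w, scal (p i) (plus w (scal mu (v i))) =
  plus (scal (p i) w) (scal (mu * p i) (v i))).
{ intros i w. rewrite scal_distr_l, scal_assoc, (Rmult_comm mu). reflexivity. }
assert (E' : forall i, scal (mulX_add mu p (S i)) (v (S i)) =
  plus (scal (p i) (v (S i))) (scal (mu * p (S i)) (v (S i)))).
{ intros i. rewrite <- scal_distr_r. apply (f_equal (fun r => scal r _)).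
  unfold mulX_add. apply Rplus_comm. }
induction d as [|d IH].
- rewrite sum_Sn, !sum_O, E, E'.
  replace (mulX_add mu p 0) with (mu * p O) by (unfold mulX_add; ring).
  rewrite !plus_assoc, (plus_comm (scal (mu * p O) (v O))). reflexivity.
- rewrite sum_Sn, IH, (sum_Sn _ d), E, E', !plus_assoc.
  apply (f_equal (fun w => plus w _)).
  rewrite <- !plus_assoc. apply f_equal, plus_comm.
Qed.

Lemma sum_n_mulX_add_pow (mu : R) (p : nat -> R) (x : R) (d : nat) :
  p (S d) = 0 ->
  sum_n (fun i => mulX_add mu p i * x ^ i) (S d) =
  (x + mu) * sum_n (fun i => p i * x ^ i) d.
Proof.
intros Hp.
eapply eq_trans; [apply (sum_n_mulX_add (V := Ring_ModuleSpace R_Ring) mu p (fun i => x ^ i) d)|].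
rewrite Hp. change (@scal R_Ring (Ring_ModuleSpace R_Ring)) with Rmult.
change (@plus (Ring_ModuleSpace R_Ring)) with Rplus.
rewrite Rmult_0_r, Rmult_0_l, Rplus_0_r.
rewrite <- (sum_n_mult_l (K := R_Ring) (x + mu)).
apply sum_n_ext. intros i. change (@mult R_Ring) with Rmult. simpl. ring.
Qed.

(** Horner's scheme: if [c = c_0 + X c'] and [c' = (X - r) p + rem], then
    [c = (X - r) (X p + rem) + (c_0 + r rem)]. *)
Lemma poly_euclid (r : R) (d : nat) (c : nat -> R) :
  exists (p : nat -> R) (rem : R), p (S d) = 0 /\
  forall i, (i <= S d)%nat ->
    c i = mulX_add (- r) p i + match i with O => rem | S _ => 0 end.
Proof.
revert c. induction d as [|d IH]; intros c.
- exists (fun i => match i with O => c 1%nat | S _ => 0 end), (c O + r * c 1%nat).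
  split; [reflexivity|].
  intros [|[|i]] Hi; unfold mulX_add; [ring|ring|lia].
- destruct (IH (fun i => c (S i))) as [p [rem [Hp Hc]]].
  exists (fun i => match i with O => rem | S i' => p i' end), (c O + r * rem).
  split; [exact Hp|].
  intros [|i] Hi.
  + unfold mulX_add. ring.
  + rewrite Hc by lia. unfold mulX_add. destruct i; ring.
Qed.

Lemma sum_n_only_0 (u : nat -> R) (rem : R) (d : nat) :
  sum_n (fun i => match i with O => rem | S _ => 0 end * u i) d = rem * u O.
Proof.
induction d as [|d IH].
- apply sum_O.
- rewrite sum_Sn, IH. unfold plus; simpl. ring.
Qed.

(** Dividing by [X - r] for one root [r] leaves remainder 0 and a quotient that vanishes at the
    other [d + 1] nodes, to which induction applies. *)
Lemma poly_roots_zero (d : nat) (c : nat -> R) (xs : list R) :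
  NoDup xs -> length xs = S d ->
  (forall x, In x xs -> sum_n (fun i => c i * x ^ i) d = 0) ->
  forall i, (i <= d)%nat -> c i = 0.
Proof.
revert c xs. induction d as [|d IH]; intros c xs ND Hlen Hroot i Hi.
- destruct xs as [|r xs]; [discriminate|].
  specialize (Hroot r (or_introl eq_refl)). rewrite sum_O in Hroot.
  replace i with O by lia. simpl in Hroot. lra.
- destruct xs as [|r xs]; [discriminate|].
  inversion ND as [|? ? Hr ND']; subst.
  destruct (poly_euclid r d c) as [p [rem [Hp Hc]]].
  assert (E : forall x, sum_n (fun i => c i * x ^ i) (S d) =
    (x - r) * sum_n (fun i => p i * x ^ i) d + rem).
  { intros x. unfold Rminus. rewrite <- (sum_n_mulX_add_pow _ _ _ _ Hp).
    replace rem with (rem * x ^ 0) at 1 by (simpl; ring).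
    rewrite <- (sum_n_only_0 (fun i => x ^ i) rem (S d)).
    rewrite <- (sum_n_plus (G := R_AbelianMonoid)). apply sum_n_ext_loc.
    intros m Hm. rewrite (Hc m Hm). unfold plus; simpl. ring. }
  assert (rem0 : rem = 0).
  { specialize (Hroot r (or_introl eq_refl)). rewrite E in Hroot. lra. }
  assert (p0 : forall m, (m <= d)%nat -> p m = 0).
  { apply (IH p xs ND').
    - simpl in Hlen. lia.
    - intros x Hx. specialize (Hroot x (or_intror Hx)).
      rewrite E, rem0, Rplus_0_r in Hroot.
      apply Rmult_integral in Hroot. destruct Hroot as [H|H]; [|exact H].
      exfalso. apply Hr. replace r with x by lra. exact Hx. }
  rewrite (Hc i Hi). unfold mulX_add.
  assert (pi : p i = 0).
  { destruct (Nat.eq_dec i (S d)) as [->|]; [exact Hp|apply p0; lia]. }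
  rewrite pi. destruct i; [rewrite rem0; ring|]. rewrite p0 by lia. ring.
Qed.

Lemma sum_n_minus_pow (p q : nat -> R) (x : R) (d : nat) :
  sum_n (fun i => (p i - q i) * x ^ i) d =
  sum_n (fun i => p i * x ^ i) d - sum_n (fun i => q i * x ^ i) d.
Proof.
assert (E := sum_n_plus (fun i => (p i - q i) * x ^ i) (fun i => q i * x ^ i) d).
rewrite (sum_n_ext _ (fun i => p i * x ^ i)) in E
  by (intros m; unfold plus; simpl; ring).
rewrite E. symmetry. apply Rplus_minus_r.
Qed.

Lemma poly_ext_coef (d : nat) (p q : nat -> R) :
  (forall x, sum_n (fun i => p i * x ^ i) d = sum_n (fun i => q i * x ^ i) d) ->
  forall i, (i <= d)%nat -> p i = q i.
Proof.
intros H i Hi. apply Rminus_diag_uniq.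
(* The difference vanishes in particular at the [d + 1] distinct points 0, ..., [d]. *)
apply (poly_roots_zero d (fun i => p i - q i) (map INR (seq 0 (S d))));
  [|now rewrite length_map, length_seq| |exact Hi].
- apply Injective_map_NoDup; [|apply seq_NoDup].
  intros u v. apply INR_eq.
- intros x _. rewrite sum_n_minus_pow. apply Rminus_diag_eq, H.
Qed.

(** The coefficients of the product of the [X + mu]. *)
Fixpoint monic_coef (mus : list R) : nat -> R :=
  match mus with
  | nil => fun i => match i with O => 1 | S _ => 0 end
  | mu :: mus' => mulX_add mu (monic_coef mus')
  end.

Definition prod_list (xs : list R) : R := fold_right Rmult 1 xs.

Lemma monic_coef_high (mus : list R) (i : nat) :
  (length mus < i)%nat -> monic_coef mus i = 0.
Proof.
revert i. induction mus as [|mu mus IH]; intros [|i] Hi; simpl in *; try lia.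
- reflexivity.
- unfold mulX_add. rewrite !IH by lia. ring.
Qed.

Lemma sum_n_monic_coef (mus : list R) (x : R) :
  sum_n (fun i => monic_coef mus i * x ^ i) (length mus) =
  prod_list (map (fun mu => x + mu) mus).
Proof.
unfold prod_list. induction mus as [|mu mus IH].
- simpl. rewrite sum_O. simpl. ring.
- simpl. rewrite sum_n_mulX_add_pow by (apply monic_coef_high; lia).
  now rewrite IH.
Qed.

(* The coefficients of [p (z ^ 2)]. *)
Definition in_square (p : nat -> R) (i : nat) : R :=
  if Nat.even i then p (Nat.div2 i) else 0.

Lemma sum_n_in_square {V : ModuleSpace R_Ring} (p : nat -> R) (v : nat -> V)
  (d : nat) :
  sum_n (fun i => scal (in_square p i) (v i)) (2 * d) =
  sum_n (fun i => scal (p i) (v (2 * i)%nat)) d.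
Proof.
assert (Ev : forall i, in_square p (2 * i) = p i).
{ intros i. unfold in_square. now rewrite Nat.even_even, Nat.div2_double. }
assert (Od : forall i, in_square p (S (2 * i)) = 0).
{ intros i. unfold in_square. now rewrite Nat.even_succ, Nat.odd_even. }
induction d as [|d IH].
- simpl. rewrite !sum_O. reflexivity.
- rewrite (sum_Sn _ d), <- IH, <- (Ev (S d)).
  replace (2 * S d)%nat with (S (S (2 * d))) by lia.
  rewrite !sum_Sn, Od.
  rewrite (scal_zero_l (v (S (2 * d))) : scal 0 _ = zero), plus_zero_r.
  reflexivity.
Qed.

Lemma minus_plus_opp {G : AbelianGroup} (p q : G) :
  minus p q = plus p (opp q).
Proof. reflexivity. Qed.

(** For the boundary terms in [is_RInt_kernel]: [p] and [q] are the halves of [F b] and [F a]. *)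
Lemma minus_zero_minus_opp {G : AbelianGroup} (p q : G) :
  minus zero (minus (opp p) q) = plus q p.
Proof.
change (@plus G zero (@opp G (@plus G (opp p) (opp q))) = @plus G q p).
now rewrite plus_zero_l, opp_plus, !opp_opp, plus_comm.
Qed.

(** For the integrands in [is_RInt_kernel]: [p] is [u' F'], [q] is [u F''], [r] is [mu u F] and [s]
    is [F / (b - a)]. *)
Lemma minus_plus_plus_opp {G : AbelianGroup} (p q r s : G) :
  minus (minus (plus p q) (@plus G (opp (plus r s)) p)) s = plus q r.
Proof.
assert (E : minus (plus p q) (@plus G (opp (plus r s)) p) = plus q (plus r s)).
{ generalize (plus r s); intros w.
  change (@plus G (@plus G p q) (@opp G (@plus G (opp w) p)) = @plus G q w).
  rewrite opp_plus, opp_opp, (plus_comm p q), <- (plus_assoc q).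
  rewrite (plus_comm w), (plus_assoc p), plus_opp_r, plus_zero_l. reflexivity. }
rewrite E, minus_plus_opp.
now rewrite <- !plus_assoc, plus_opp_r, plus_zero_r.
Qed.

(** * Vector-valued calculus on a compact interval *)

Definition clamp (a b x : R) : R := Rmax a (Rmin b x).

Lemma clamp_id (a b x : R) : a <= x <= b -> clamp a b x = x.
Proof. intros H. unfold clamp. rewrite Rmin_right, Rmax_right; lra. Qed.

Section Calculus.

Context {V : CompleteNormedModule R_AbsRing}.
Variables a b : R.
Hypothesis ab : a < b.

Let on_ab (x : R) := a <= x <= b.

Lemma clamp_on (x : R) : on_ab (clamp a b x).
Proof.
unfold on_ab, clamp. split; [apply Rmax_l|].
apply Rmax_lub; [lra|apply Rmin_l].
Qed.

(** The retraction [clamp] onto [[a, b]] does not increase distances, so it maps a ball around [x]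
    into the relative ball of the same radius. *)
Lemma continuous_clamp (L : R -> V) (x : R) :
  continuous_on on_ab L -> on_ab x ->
  continuous (fun y => L (clamp a b y)) x.
Proof.
intros HL Hx. unfold continuous. rewrite (clamp_id a b x Hx).
apply (filterlim_comp _ _ _ (clamp a b) L _ (within on_ab (locally x)));
  [|now apply HL].
intros P [d Hd]. exists d. intros y Hy. apply Hd; [|apply clamp_on].
revert Hy. unfold ball; simpl; unfold AbsRing_ball, abs, minus, plus, opp; simpl.
unfold clamp, Rmax, Rmin. unfold on_ab in Hx. intros Hy.
apply Rabs_def2 in Hy. apply Rabs_def1;
repeat destruct Rle_dec; lra.
Qed.

(** Continues [F] beyond [a] and [b] along lines of slopes [L a] and [L b], so that one-sided
    derivatives at the endpoints become two-sided ones. *)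
Definition affine_ext (F L : R -> V) (x : R) : V :=
  plus (F (clamp a b x)) (scal (x - clamp a b x) (L (clamp a b x))).

Lemma affine_ext_id (F L : R -> V) (x : R) :
  on_ab x -> affine_ext F L x = F x.
Proof.
intros Hx. unfold affine_ext. rewrite (clamp_id a b x Hx).
unfold Rminus. rewrite Rplus_opp_r.
rewrite (scal_zero_l (L x) : scal 0 _ = zero). apply plus_zero_r.
Qed.

Lemma is_derive_affine_ext (F L : R -> V) (x : R) :
  on_ab x -> is_derive_on a b F x (L x) ->
  is_derive (affine_ext F L) x (L x).
Proof.
intros Hx [Hlin HF]. split; [exact Hlin|].
intros x' Hx'.
assert (Ex : x = x') by now apply is_filter_lim_locally_unique.
subst x'. clear Hx'.
assert (Hlim : is_filter_lim (within on_ab (locally x)) x).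
{ intros P HP. apply filter_imp with (2 := HP). now intros y Hy _. }
intros eps. specialize (HF x Hlim eps). destruct HF as [d Hd].
(* The radius stays below the distance from [x] to each endpoint other than [x]; the value 1 is an
   arbitrary choice when [x] is that endpoint. A [y] outside [[a, b]] within this radius thus lies
   just beyond [x], and [clamp a b y = x]. *)
assert (Hd' : 0 < Rmin d (Rmin (if Rle_dec x a then 1 else x - a)
                               (if Rle_dec b x then 1 else b - x))).
{ assert (d0 := cond_pos d).
  repeat apply Rmin_glb_lt; try assumption; destruct Rle_dec; lra. }
exists (mkposreal _ Hd'). intros y Hy.
rewrite (affine_ext_id F L x Hx).
destruct (Rlt_dec y a) as [ya|ya]; [|destruct (Rlt_dec b y) as [yb|yb]].
3: { assert (Hyab : on_ab y) by (unfold on_ab; lra).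
  rewrite (affine_ext_id F L y Hyab). apply Hd; [|exact Hyab].
  apply Rlt_le_trans with (1 := Hy). apply Rmin_l. }
all: assert (E : clamp a b y = x).
1, 3: unfold ball in Hy; simpl in Hy;
  unfold AbsRing_ball, abs, minus, plus, opp in Hy; simpl in Hy;
  unfold on_ab in Hx; apply Rabs_def2 in Hy; revert Hy;
  unfold clamp, Rmax, Rmin; repeat destruct Rle_dec; lra.
(* Beyond the endpoint the extension is affine with slope [L x], so the linearization error is
   exactly 0. *)
all: apply Rle_trans with 0;
  [right|apply Rmult_le_pos; [apply Rlt_le, cond_pos|apply norm_ge_0]];
  eapply eq_trans; [apply f_equal|apply (norm_zero (V := V))];
  unfold affine_ext; rewrite E;
  eapply eq_trans; [|apply (minus_eq_zero (scal (y - x) (L x)))];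
  apply (f_equal (fun w => minus w _));
  rewrite minus_plus_opp, (plus_comm (F x)), <- plus_assoc, plus_opp_r;
  apply plus_zero_r.
Qed.

Lemma is_derive_on_continuous_on (F L : R -> V) :
  (forall x, on_ab x -> is_derive_on a b F x (L x)) -> continuous_on on_ab F.
Proof.
intros HF x Hx.
apply (filterdiff_continuous_aux F (F := within on_ab (locally x))).
{ eexists. apply (HF x Hx). }
intros P HP. apply filter_imp with (2 := HP). now intros y Hy _.
Qed.

(** The product rule is integrated for [affine_ext F F'] and for [F'] composed with [clamp], which
    agree with [F] and [F'] on [[a, b]]. *)
Lemma is_RInt_scal_derive_on (u u' : R -> R) (F F' : R -> V) :
  (forall x, is_derive u x (u' x)) ->
  (forall x, continuous u' x) ->
  (forall x, on_ab x -> is_derive_on a b F x (F' x)) ->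
  continuous_on on_ab F' ->
  is_RInt (fun t => plus (scal (u' t) (F t)) (scal (u t) (F' t))) a b
    (minus (scal (u b) (F b)) (scal (u a) (F a))).
Proof.
intros Hu Hu' HF HF'.
rewrite <- (affine_ext_id F F' a), <- (affine_ext_id F F' b)
  by (unfold on_ab; lra).
apply is_RInt_ext with (f := fun t => plus (scal (u' t) (affine_ext F F' t))
  (scal (u t) (F' (clamp a b t)))).
- rewrite Rmin_left, Rmax_right by lra. intros x Hx.
  rewrite affine_ext_id by (unfold on_ab; lra).
  rewrite clamp_id by lra. reflexivity.
- apply is_RInt_scal_derive; rewrite Rmin_left, Rmax_right by lra;
    intros t Ht; auto.
  + rewrite (clamp_id a b t Ht). apply is_derive_affine_ext; auto.
  + now apply continuous_clamp.
Qed.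

Lemma ex_RInt_continuous_on (F : R -> V) :
  continuous_on on_ab F -> ex_RInt F a b.
Proof.
intros HF. apply ex_RInt_ext with (f := fun t => F (clamp a b t)).
- rewrite Rmin_left, Rmax_right by lra. intros x Hx.
  rewrite clamp_id by lra. reflexivity.
- apply ex_RInt_continuous. rewrite Rmin_left, Rmax_right by lra.
  intros z Hz. now apply continuous_clamp.
Qed.

Lemma is_RInt_sum_n (F : nat -> R -> V) (I : nat -> V) (d : nat) :
  (forall i, (i <= d)%nat -> is_RInt (F i) a b (I i)) ->
  is_RInt (fun t => sum_n (fun i => F i t) d) a b (sum_n I d).
Proof.
induction d as [|d IH]; intros H.
- rewrite sum_O. apply is_RInt_ext with (f := F O); [|apply H; lia].
  intros x _. now rewrite sum_O.
- rewrite sum_Sn. apply is_RInt_ext with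
    (f := fun t => plus (sum_n (fun i => F i t) d) (F (S d) t)).
  + intros x _. now rewrite sum_Sn.
  + refine (is_RInt_plus (V := V) _ _ _ _ _ _ (IH _) (H _ _));
    [intros; apply H|]; lia.
Qed.

Definition trapezoid_defect (F : R -> V) : V :=
  minus (scal (1 / 2) (plus (F a) (F b))) (scal (1 / (b - a)) (RInt F a b)).

(* Two integrations by parts: the boundary values of [u'] produce the
   trapezoid, and the constant [u'' + mu u] the mean. *)
Lemma is_RInt_kernel (mu : R) (u u' : R -> R) (F F' F'' : R -> V) :
  (forall x, is_derive u x (u' x)) ->
  (forall x, is_derive u' x (- mu * u x - 1 / (b - a))) ->
  u a = 0 -> u b = 0 -> u' a = 1 / 2 -> u' b = - (1 / 2) ->
  (forall x, on_ab x -> is_derive_on a b F x (F' x)) ->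
  (forall x, on_ab x -> is_derive_on a b F' x (F'' x)) ->
  continuous_on on_ab F'' ->
  is_RInt (fun t => scal (u t) (plus (F'' t) (scal mu (F t)))) a b
    (trapezoid_defect F).
Proof.
intros Hu Hu' ua ub u'a u'b HF HF' HF''.
assert (cF : continuous_on on_ab F) by now apply is_derive_on_continuous_on with F'.
assert (cF' : continuous_on on_ab F') by now apply is_derive_on_continuous_on with F''.
assert (cu : forall x, continuous u x).
{ intros x. apply (ex_derive_continuous u). eexists; apply Hu. }
assert (I1 := is_RInt_scal_derive_on u u' F' F'' Hu
  (fun x => ex_derive_continuous u' x (ex_intro _ _ (Hu' x))) HF' HF'').
assert (I2 : is_RInt _ a b _) by
 (refine (is_RInt_scal_derive_on u' _ F F' Hu' _ HF cF');
  intros x; apply (continuous_minus (V := R_NormedModule));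
  [|apply continuous_const];
  apply (continuous_mult (K := R_AbsRing)); [apply continuous_const|apply cu]).
assert (I3 := is_RInt_scal _ a b (1 / (b - a)) _
  (RInt_correct _ _ _ (ex_RInt_continuous_on F cF))).
(* The terms [u' F'] cancel between [I1] and [I2], and [I3] removes the [F / (b - a)] that comes
   from [- u'' F]. *)
assert (I := is_RInt_minus _ _ _ _ _ _ (is_RInt_minus _ _ _ _ _ _ I1 I2) I3).
rewrite ua, ub, u'a, u'b in I.
match type of I with is_RInt _ _ _ ?l => replace (trapezoid_defect F) with l end.
- apply is_RInt_ext with (2 := I). intros x _. clear.
  set (h := 1 / (b - a)).
  assert (E : scal (- mu * u x - h) (F x) =
    opp (plus (scal (u x) (scal mu (F x))) (scal h (F x)))).
  { rewrite scal_assoc, <- scal_distr_r, <- scal_opp_l.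
    apply (f_equal (fun r => scal r (F x))).
    unfold opp, plus, mult; simpl. ring. }
  rewrite E. eapply eq_trans; [apply (minus_plus_plus_opp (G := V))|].
  symmetry. apply (scal_distr_l (V := V)).
- unfold trapezoid_defect. apply (f_equal (fun w => minus w _)).
  rewrite !(scal_zero_l _ : scal 0 (F' _) = zero), minus_eq_zero.
  rewrite (scal_opp_l (1 / 2) (F b) : scal (- (1 / 2)) (F b) = _).
  rewrite (minus_zero_minus_opp (G := V)).
  symmetry. apply (scal_distr_l (V := V)).
Qed.

End Calculus.

(** * The kernels and their weights *)

(** The number [(m + 1/2) PI] separates the branch of [m] from that of [m']. *)
Lemma tau_lt (m m' : Z) : (m < m')%Z -> tau m < tau m'.
Proof.
intros H. destruct (tau_correct m) as [[_ H1] _].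
destruct (tau_correct m') as [[H2 _] _].
apply Rlt_trans with (1 := H1). apply Rle_lt_trans with (2 := H2).
apply Rmult_le_compat_r; [apply Rlt_le, PI_RGT_0|].
assert (L := IZR_le (m + 1) m' ltac:(lia)). rewrite plus_IZR in L. lra.
Qed.

Lemma tau_0 : tau 0 = 0.
Proof.
apply (is_tan_fixpoint_inj 0); [apply tau_correct|].
split; [|apply tan_0]. assert (H := PI_RGT_0). simpl. lra.
Qed.

(** The function [u_j] of the overview. The quadratic is the limit of the trigonometric formula as
    [lam] tends to 0. *)
Definition kernel (a b lam t : R) : R :=
  if Req_EM_T lam 0 then (b - t) * (t - a) / (2 * (b - a))
  else sin (lam * (b - t) / 2) * sin (lam * (t - a) / 2) /
       (lam * sin (lam * (b - a) / 2)).

Definition kernel' (a b lam t : R) : R :=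
  if Req_EM_T lam 0 then (a + b - 2 * t) / (2 * (b - a))
  else sin (lam * (a + b - 2 * t) / 2) / (2 * sin (lam * (b - a) / 2)).

Section Kernel.

Variables a b : R.
Hypothesis ab : a < b.
Variable m : Z.

Let lam := 2 / (b - a) * tau m.

(** This is [tan v = v] at [v = tau m], cleared of the denominator [cos v], which is nonzero on the
    branch. *)
Lemma sin_lambda :
  sin (lam * (b - a) / 2) = lam * (b - a) / 2 * cos (lam * (b - a) / 2).
Proof.
destruct (tau_correct m) as [H T].
replace (lam * (b - a) / 2) with (tau m) by (unfold lam; field; lra).
rewrite <- T at 2. unfold tan. field. now apply (cos_neq_0_branch m).
Qed.

Lemma sin_lambda_neq_0 : lam <> 0 -> sin (lam * (b - a) / 2) <> 0.
Proof.
intros H. rewrite sin_lambda.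
apply Rmult_integral_contrapositive_currified.
- apply Rmult_integral_contrapositive_currified; [|lra].
  apply Rmult_integral_contrapositive_currified; lra.
- replace (lam * (b - a) / 2) with (tau m) by (unfold lam; field; lra).
  destruct (tau_correct m) as [Hm _]. now apply (cos_neq_0_branch m).
Qed.

Lemma is_derive_kernel (x : R) :
  is_derive (kernel a b lam) x (kernel' a b lam x).
Proof.
unfold kernel, kernel'. destruct (Req_EM_T lam 0) as [l0|l0].
- auto_derive; [trivial|]. field. lra.
- assert (s0 := sin_lambda_neq_0 l0).
  auto_derive; [trivial|].
  replace (lam * (a + b - 2 * x) / 2)
    with (lam * (b - x) / 2 - lam * (x - a) / 2) by field.
  rewrite sin_minus. unfold Rdiv, Rminus. field. split; assumption.
Qed.

(* The constant term [- lam cos v / (2 sin v)] with [v := lam (b - a) / 2]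
   equals [- 1 / (b - a)] precisely because [tan v = v]. *)
Lemma is_derive_kernel' (x : R) :
  is_derive (kernel' a b lam) x (- lam ^ 2 * kernel a b lam x - 1 / (b - a)).
Proof.
unfold kernel, kernel'. destruct (Req_EM_T lam 0) as [l0|l0].
- auto_derive; [trivial|]. rewrite l0. field. lra.
- assert (s0 := sin_lambda_neq_0 l0).
  auto_derive; [trivial|].
  replace (1 / (b - a)) with
    (lam * cos (lam * (b - a) / 2) / (2 * sin (lam * (b - a) / 2))).
  2: { rewrite sin_lambda in s0 |- *.
       field. repeat split; try lra.
       intros E. apply s0. rewrite E. ring. }
  (* With [A = lam (b - x) / 2] and [B = lam (x - a) / 2], what remains is [cos (A - B) - cos (A +
     B) = 2 sin A sin B]. *)
  replace (cos (lam * (b - a) / 2)) with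
    (cos (lam * (b - x) / 2 + lam * (x - a) / 2)) by (f_equal; field).
  replace (lam * (a + b + - (2 * x)) * / 2)
    with (lam * (b - x) / 2 - lam * (x - a) / 2) by field.
  rewrite cos_minus, cos_plus. unfold Rdiv, Rminus. field. split; assumption.
Qed.

Lemma kernel_bounds : kernel a b lam a = 0 /\ kernel a b lam b = 0 /\
  kernel' a b lam a = 1 / 2 /\ kernel' a b lam b = - (1 / 2).
Proof.
unfold kernel, kernel'. destruct (Req_EM_T lam 0) as [l0|l0].
- repeat split; field; lra.
- assert (s0 := sin_lambda_neq_0 l0).
  replace (lam * (a - a) / 2) with 0 by field.
  replace (lam * (b - b) / 2) with 0 by field.
  replace (lam * (a + b - 2 * a) / 2) with (lam * (b - a) / 2) by field.
  replace (lam * (a + b - 2 * b) / 2) with (- (lam * (b - a) / 2)) by field.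
  rewrite sin_0, sin_neg. repeat split; field; auto.
Qed.

End Kernel.

Definition others (k j : nat) : list nat :=
  filter (fun l => negb (l =? j)%nat) (seq 1 k).

Lemma in_others (k j l : nat) :
  In l (others k j) <-> (1 <= l <= k)%nat /\ l <> j.
Proof.
unfold others. rewrite filter_In, in_seq, Bool.negb_true_iff, Nat.eqb_neq. lia.
Qed.

Lemma prod_list_remove (h : nat -> R) (j : nat) (l : list nat) :
  NoDup l -> In j l ->
  prod_list (map h l) =
  h j * prod_list (map h (filter (fun i => negb (i =? j)%nat) l)).
Proof.
unfold prod_list. induction l as [|i l IH]; intros ND Hj; [destruct Hj|].
inversion ND as [|? ? Hi ND']; subst. simpl.
destruct (Nat.eqb_spec i j) as [->|ij]; simpl.
- f_equal. f_equal. f_equal. clear - Hi. induction l as [|i l IH]; [reflexivity|].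
  simpl in *. destruct (Nat.eqb_spec i j) as [->|ij]; [tauto|].
  simpl. f_equal. tauto.
- rewrite IH; [ring|exact ND'|]. destruct Hj; [congruence|assumption].
Qed.

(** The filter and its complement partition [seq 1 k], and [j] occurs there exactly once. *)
Lemma length_others (k j : nat) :
  (1 <= j <= k)%nat -> S (length (others k j)) = k.
Proof.
intros Hj. rewrite <- (length_seq k 1) at 2.
rewrite <- (filter_length (fun l => l =? j)%nat (seq 1 k)).
fold (others k j).
change (S (length (others k j))) with (1 + length (others k j))%nat.
f_equal.
transitivity (count_occ Nat.eq_dec (seq 1 k) j).
- symmetry. apply NoDup_count_occ'; [apply seq_NoDup|]. apply in_seq. lia.
- induction (seq 1 k) as [|i l IH]; [reflexivity|]. simpl.
  destruct (Nat.eq_dec i j), (Nat.eqb_spec i j); simpl; congruence.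
Qed.

Lemma prod_list_eq_0 (h : nat -> R) (l : list nat) :
  prod_list (map h l) = 0 <-> exists i, In i l /\ h i = 0.
Proof.
unfold prod_list. induction l as [|i l IH]; simpl.
- split; [lra|]. intros [i [[] _]].
- split.
  + intros H. apply Rmult_integral in H. destruct H as [H|H]; [now exists i; auto|].
    apply IH in H. destruct H as [i' H]. exists i'. tauto.
  + intros [i' [[->|Hi] H]]; [rewrite H; ring|].
    rewrite (proj2 IH); [ring|now exists i'].
Qed.

Section Weights.

Variables (k : nat) (lam : nat -> R).
Hypothesis lam_sq_inj : forall i j, (1 <= i <= k)%nat -> (1 <= j <= k)%nat ->
  lam i ^ 2 = lam j ^ 2 -> i = j.

(** The polynomial [P_j] of the overview; its value at [- z ^ 2] is [Q k lam j z]. *)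
Let coef (j : nat) : nat -> R :=
  monic_coef (map (fun l => lam l ^ 2) (others k j)).

Lemma Q_prod_list (j : nat) (z : R) :
  Q k lam j z = prod_list (map (fun l => lam l ^ 2 - z ^ 2) (others k j)).
Proof. reflexivity. Qed.

(** As the squares are distinct, a factor [lam l ^ 2 - lam i ^ 2] vanishes only for [l = i], and
    this factor is present unless [i = j]. *)
Lemma Q_eq_0 (j i : nat) : (1 <= i <= k)%nat ->
  Q k lam j (lam i) = 0 <-> i <> j.
Proof.
intros Hi. rewrite Q_prod_list, prod_list_eq_0. split.
- intros [l [Hl E]]. apply in_others in Hl.
  rewrite (lam_sq_inj i l); [tauto|tauto|tauto|lra].
- intros ij. exists i. rewrite in_others. split; [tauto|ring].
Qed.

Lemma sum_n_coef (d j : nat) (x : R) : k = S d -> (1 <= j <= k)%nat ->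
  sum_n (fun i => coef j i * x ^ i) d =
  prod_list (map (fun l => x + lam l ^ 2) (others k j)).
Proof.
intros kd Hj. assert (L := length_others k j Hj).
replace d with (length (map (fun l => lam l ^ 2) (others k j)))
  by (rewrite length_map; lia).
unfold coef. now rewrite sum_n_monic_coef, map_map.
Qed.

(* Lagrange interpolation of the constant 1 at the nodes [- lam i ^ 2]. *)
Lemma sum_n_weights_coef (d i : nat) : k = S d -> (i <= d)%nat ->
  sum_n (fun j => / Q k lam (S j) (lam (S j)) * coef (S j) i) d =
  match i with O => 1 | S _ => 0 end.
Proof.
intros kd Hi. apply Rminus_diag_uniq. revert i Hi.
apply (poly_roots_zero d _ (map (fun l => - lam l ^ 2) (seq 1 k))).
- apply NoDup_map_NoDup_ForallPairs; [|apply seq_NoDup].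
  intros u v Hu Hv E. apply in_seq in Hu, Hv.
  apply lam_sq_inj; [lia|lia|lra].
- rewrite length_map, length_seq. exact kd.
- intros x Hx. apply in_map_iff in Hx. destruct Hx as [p [<- Hp]].
  apply in_seq in Hp.
  set (x := - lam p ^ 2).
  set (w := fun j => / Q k lam (S j) (lam (S j))).
  (* Exchanging the sums evaluates the interpolating polynomial at the node [x]. *)
  assert (E1 : sum_n (fun i => sum_n (fun j => w j * coef (S j) i) d * x ^ i) d =
    sum_n (fun j => w j * Q k lam (S j) (lam p)) d).
  { eapply eq_trans.
    { apply sum_n_ext. intros i. symmetry.
      apply (sum_n_mult_r (K := R_Ring) (x ^ i)). }
    eapply eq_trans; [apply (sum_n_switch (G := R_AbelianMonoid))|].
    apply sum_n_ext_loc. intros j Hj.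
    rewrite Q_prod_list.
    rewrite (map_ext _ (fun l => x + lam l ^ 2)) by (intros; unfold x; ring).
    rewrite <- (sum_n_coef d) by lia.
    rewrite <- (sum_n_mult_l (K := R_Ring)). apply sum_n_ext. intros i.
    unfold mult; simpl. ring. }
  (* Only the term with [S j = p] is nonzero, and it is 1; the partial sums therefore jump from 0 to
     1 there. *)
  assert (E2 : forall e, (e <= d)%nat ->
    sum_n (fun j => w j * Q k lam (S j) (lam p)) e =
    if (p <=? S e)%nat then 1 else 0).
  { assert (V : forall e, (e <= d)%nat -> w e * Q k lam (S e) (lam p) =
      if (p =? S e)%nat then 1 else 0).
    { intros e He. destruct (Nat.eqb_spec p (S e)) as [->|ne].
      - unfold w. apply Rinv_l. rewrite Q_eq_0 by lia. tauto.
      - rewrite (proj2 (Q_eq_0 (S e) p ltac:(lia)) ne). ring. }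
    induction e as [|e IH]; intros He.
    - rewrite sum_O, V by lia.
      destruct (Nat.eqb_spec p 1), (Nat.leb_spec p 1); reflexivity || lia.
    - rewrite sum_Sn, IH, V by lia. unfold plus; simpl plus.
      destruct (Nat.eqb_spec p (S (S e))), (Nat.leb_spec p (S e)),
        (Nat.leb_spec p (S (S e))); simpl; lia || ring. }
  rewrite E2 in E1 by lia.
  replace (p <=? S d)%nat with true in E1 by (symmetry; apply Nat.leb_le; lia).
  rewrite sum_n_minus_pow.
  eapply eq_trans; [apply f_equal2; [exact E1|apply sum_n_only_0]|].
  simpl. ring.
Qed.

End Weights.

(** * Derivatives of [f], factorization of [D_c] and expansion of [g] *)

Lemma sum_n_scal_r {V : ModuleSpace R_Ring} (w : nat -> R) (v : V) (d : nat) :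
  sum_n (fun j => scal (w j) v) d = scal (sum_n w d) v.
Proof.
induction d as [|d IH]; [now rewrite !sum_O|].
rewrite !sum_Sn, IH. symmetry. apply (scal_distr_r (V := V)).
Qed.

(** [Derive_on] is a choice by [iota]; uniqueness of the derivative on a nondegenerate interval
    identifies it with any derivative that exists. *)
Lemma is_derive_Derive_n_on {V : CompleteNormedModule R_AbsRing} (a b : R)
  (m i : nat) (f : R -> V) (x : R) :
  a < b -> C_n_on a b m f -> (i < m)%nat -> a <= x <= b ->
  is_derive_on a b (Derive_n_on a b f i) x (Derive_n_on a b f (S i) x).
Proof.
intros ab [Hf _] Hi Hx. destruct (Hf i x Hi Hx) as [l Hl]. simpl.
now rewrite (is_derive_on_unique a b _ x l ab Hx Hl).
Qed.

Lemma continuous_Derive_n_on {V : CompleteNormedModule R_AbsRing} (a b : R)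
  (m i : nat) (f : R -> V) :
  a < b -> C_n_on a b m f -> (i <= m)%nat ->
  continuous_on (fun x => a <= x <= b) (Derive_n_on a b f i).
Proof.
intros ab Hf Hi. destruct (Nat.eq_dec i m) as [->|]; [apply Hf|].
apply is_derive_on_continuous_on with (L := Derive_n_on a b f (S i)).
intros x Hx. apply (is_derive_Derive_n_on a b m); [assumption..|lia|assumption].
Qed.

Lemma char_poly_prod_list (k : nat) (lam : nat -> R) (x : R) :
  char_poly k lam (RtoC x) =
  RtoC (prod_list (map (fun j => x ^ 2 + lam j ^ 2) (seq 1 k))).
Proof.
unfold char_poly, prod_list. induction (seq 1 k) as [|j l IH]; [reflexivity|].
cbn [map fold_right]. rewrite IH, <- RtoC_pow, <- RtoC_plus, <- RtoC_mult.
reflexivity.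
Qed.

Lemma sum_n_RtoC (c : nat -> R) (x : R) (d : nat) :
  sum_n (fun i => Cmult (RtoC (c i)) (Cpow (RtoC x) i)) d =
  RtoC (sum_n (fun i => c i * x ^ i) d).
Proof.
induction d as [|d IH].
- rewrite !sum_O, <- RtoC_pow, <- RtoC_mult. reflexivity.
- rewrite !sum_Sn, IH, <- RtoC_pow, <- RtoC_mult. symmetry. apply RtoC_plus.
Qed.

(** At a real [x] the characteristic polynomial is [(x ^ 2 + lam j ^ 2) P_j(x ^ 2)]. Agreement at
    real points already determines the coefficients. *)
Lemma char_poly_factor (k : nat) (lam c : nat -> R) (j : nat) :
  (forall z : C, char_poly k lam z =
     sum_n (fun i => Cmult (RtoC (c i)) (Cpow z i)) (2 * k)) ->
  (1 <= j <= k)%nat ->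
  forall i, (i <= 2 * k)%nat ->
  c i = in_square (mulX_add (lam j ^ 2)
    (monic_coef (map (fun l => lam l ^ 2) (others k j)))) i.
Proof.
intros Hc Hj. apply poly_ext_coef. intros x.
apply RtoC_inj. rewrite <- sum_n_RtoC, <- Hc, char_poly_prod_list. f_equal.
destruct k as [|d]; [lia|]. symmetry.
eapply eq_trans.
{ apply (sum_n_in_square (V := Ring_ModuleSpace R_Ring) _ (fun i => x ^ i)). }
eapply eq_trans.
{ apply sum_n_ext. intros i. rewrite pow_mult. reflexivity. }
eapply eq_trans.
{ apply (sum_n_mulX_add_pow (lam j ^ 2) _ (x ^ 2) d).
  apply monic_coef_high. rewrite length_map.
  assert (L := length_others (S d) j Hj). lia. }
rewrite (sum_n_coef (S d) lam d j (x ^ 2)) by (reflexivity || assumption).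
symmetry. apply (prod_list_remove (fun l => x ^ 2 + lam l ^ 2));
  [apply seq_NoDup|apply in_seq; lia].
Qed.

(** The case distinction of [g] on [n 1] becomes that of [kernel] on [lam = 0]: [lam 1] is zero when
    [n 1 = 0], and every positive [n j] gives a nonzero [lam j]. The summation index is shifted to
    start at 0. *)
Lemma g_sum_kernel (a b : R) (k d : nat) (n : nat -> Z) (t : R) :
  a < b -> k = S d -> (0 <= n 1%nat)%Z ->
  (forall j, (1 < j <= k)%nat -> (0 < n j)%Z) ->
  (forall j, (1 <= j <= k)%nat ->
     Q k (lambda a b n) j (lambda a b n j) <> 0) ->
  g a b k n t =
  sum_n (fun j => / Q k (lambda a b n) (S j) (lambda a b n (S j)) *
                  kernel a b (lambda a b n (S j)) t) d.
Proof.
intros ab kd n1 n_pos HQ. unfold g.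
set (lam := lambda a b n) in *.
assert (lam_neq_0 : forall j, (0 < n j)%Z -> lam j <> 0).
{ intros j Hj. apply tau_lt in Hj. rewrite tau_0 in Hj. unfold lam, lambda.
  apply Rmult_integral_contrapositive_currified; [|lra].
  apply Rmult_integral_contrapositive_currified; [lra|].
  apply Rinv_neq_0_compat. lra. }
assert (term : forall j, (1 <= j <= k)%nat -> (0 < n j)%Z ->
  g_term a b k lam t j = / Q k lam j (lam j) * kernel a b (lam j) t).
{ intros j Hj nj. assert (l0 := lam_neq_0 j nj).
  unfold g_term, kernel. destruct Req_EM_T as [l0'|_]; [contradiction|].
  assert (q0 := HQ j Hj).
  assert (s0 := sin_lambda_neq_0 a b ab (n j) l0).
  change (2 / (b - a) * tau (n j)) with (lam j) in s0.
  field. repeat split; assumption. }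
destruct (Z.ltb_spec 0 (n 1%nat)) as [n1'|n1'].
- rewrite kd at 2. rewrite <- sum_n_m_S. apply sum_n_ext_loc. intros j Hj.
  apply term; [lia|]. destruct j; [exact n1'|]. apply n_pos. lia.
- assert (l1 : lam 1%nat = 0).
  { unfold lam, lambda. replace (n 1%nat) with 0%Z by lia.
    rewrite tau_0. apply Rmult_0_r. }
  assert (q0 : Q k lam 1 0 <> 0) by (rewrite <- l1 at 1; apply HQ; lia).
  assert (E : (b - t) * (t - a) / (2 * Q k lam 1 0 * (b - a)) =
    / Q k lam 1 (lam 1%nat) * kernel a b (lam 1%nat) t).
  { unfold kernel. destruct Req_EM_T as [_|l1']; [|contradiction].
    rewrite l1. field. split; [lra|assumption]. }
  rewrite E. unfold sum_n. rewrite (sum_Sn_m _ 0 d) by lia.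
  apply (f_equal (Rplus _)). rewrite kd at 2. rewrite <- sum_n_m_S.
  apply sum_n_m_ext_loc. intros j Hj. apply term; [lia|]. apply n_pos. lia.
Qed.


Theorem theorem4p4 :
  forall (K : scalar_field) (k : nat) (n : nat -> Z) (a b : R) (c : nat -> R),
  (1 <= k)%nat ->
  (0 <= n 1%nat)%Z ->
  (forall i j : nat, (1 <= i)%nat -> (i < j)%nat -> (j <= k)%nat ->
     (n i < n j)%Z) ->
  a < b ->
  (forall z : C,
     char_poly k (lambda a b n) z =
     sum_n (fun i => Cmult (RtoC (c i)) (Cpow z i)) (2 * k)) ->
  forall f : R -> scalars K,
  C_n_on a b (2 * k) f ->
  minus (scal (1 / 2) (plus (f a) (f b)))
        (scal (1 / (b - a)) (RInt f a b)) =
  RInt (fun t => scal (g a b k n t) (diff_op a b (2 * k) c f t)) a b.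
Proof.
intros K k n a b c Hk n1 n_lt ab Hc f Hf.
set (lam := lambda a b n) in *.
destruct k as [|d]; [lia|]. set (k := S d) in *.
assert (lam_lt : forall i j, (1 <= i)%nat -> (i < j)%nat -> (j <= k)%nat ->
  lam i < lam j).
{ intros i j Hi Hij Hj. apply Rmult_lt_compat_l.
  - apply Rdiv_lt_0_compat; lra.
  - apply tau_lt, n_lt; assumption. }
assert (lam_ge_0 : forall j, (1 <= j <= k)%nat -> 0 <= lam j).
{ assert (0 <= lam 1%nat).
  { apply Rmult_le_pos; [apply Rlt_le, Rdiv_lt_0_compat; lra|].
    rewrite <- tau_0. destruct (Z.eq_dec (n 1%nat) 0) as [->|]; [lra|].
    apply Rlt_le, tau_lt. lia. }
  intros j Hj. destruct (Nat.eq_dec j 1) as [->|]; [assumption|].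
  assert (lam 1%nat < lam j) by (apply lam_lt; lia). lra. }
(* The [lam j] are nonnegative and strictly increasing, so the interpolation nodes [- lam j ^ 2] are
   distinct. *)
assert (lam_sq_inj : forall i j, (1 <= i <= k)%nat -> (1 <= j <= k)%nat ->
  lam i ^ 2 = lam j ^ 2 -> i = j).
{ intros i j Hi Hj E. rewrite <- !Rsqr_pow2 in E.
  apply Rsqr_inj in E; [|now apply lam_ge_0..].
  destruct (Nat.lt_trichotomy i j) as [H|[H|H]]; [|exact H|];
    apply lam_lt in H; lia || lra. }
(* From here on [j] runs from 0 to [d] and stands for the index [S j], while [i] counts powers of
   the second derivative. *)
set (coef := fun j => monic_coef (map (fun l => lam l ^ 2) (others k (S j)))).
set (w := fun j => / Q k lam (S j) (lam (S j))).
set (u := fun j => kernel a b (lam (S j))).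
set (F := fun i => Derive_n_on a b f i).
set (D := fun j i t => plus (F (2 * S i)%nat t)
                            (scal (lam (S j) ^ 2) (F (2 * i)%nat t))).
set (I := fun i => trapezoid_defect a b (F (2 * i)%nat)).
(* The value [I i] is the same for all [j]; this allows the sums over [j] and [i] to be exchanged at
   the end. *)
assert (HI : forall j i, (i <= d)%nat ->
  is_RInt (fun t => scal (u j t) (D j i t)) a b (I i)).
{ intros j i Hi. destruct (kernel_bounds a b ab (n (S j))) as [? [? [? ?]]].
  assert (E : (2 * S i = S (S (2 * i)))%nat) by lia.
  unfold D. rewrite E.
  apply is_RInt_kernel with (u' := kernel' a b (lam (S j)))
    (F' := F (S (2 * i))); try assumption.
  - apply (is_derive_kernel a b ab).
  - apply (is_derive_kernel' a b ab).
  - intros x Hx. apply (is_derive_Derive_n_on a b (2 * k)); try assumption. lia.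
  - intros x Hx. apply (is_derive_Derive_n_on a b (2 * k)); try assumption. lia.
  - apply (continuous_Derive_n_on a b (2 * k)); try assumption. lia. }
assert (Hop : forall j t, (j <= d)%nat ->
  diff_op a b (2 * k) c f t = sum_n (fun i => scal (coef j i) (D j i t)) d).
{ intros j t Hj. unfold diff_op.
  eapply eq_trans.
  { apply sum_n_ext_loc. intros i Hi.
    rewrite (char_poly_factor k lam c (S j) Hc ltac:(lia) i Hi). reflexivity. }
  eapply eq_trans; [apply (sum_n_in_square _ (fun i => F i t))|].
  eapply eq_trans; [apply (sum_n_mulX_add _ _ (fun i => F (2 * i)%nat t))|].
  (* [P_j] has degree [d], so the truncation term is zero. *)
  rewrite monic_coef_high.
  2: { rewrite length_map. assert (L := length_others k (S j) ltac:(lia)). lia. }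
  rewrite Rmult_0_r.
  rewrite (scal_zero_l _ : scal 0 (F (2 * S d)%nat t) = zero).
  apply plus_zero_r. }
symmetry. apply is_RInt_unique.
assert (H : is_RInt (fun t => sum_n (fun j => scal (w j)
    (sum_n (fun i => scal (coef j i) (scal (u j t) (D j i t))) d)) d) a b
  (sum_n (fun j => scal (w j) (sum_n (fun i => scal (coef j i) (I i)) d)) d)).
{ apply (is_RInt_sum_n a b (fun j t => scal (w j)
    (sum_n (fun i => scal (coef j i) (scal (u j t) (D j i t))) d))).
  intros j _.
  apply (is_RInt_scal (fun t =>
    sum_n (fun i => scal (coef j i) (scal (u j t) (D j i t))) d)).
  apply (is_RInt_sum_n a b (fun i t =>
    scal (coef j i) (scal (u j t) (D j i t)))).
  intros i Hi. apply (is_RInt_scal (fun t => scal (u j t) (D j i t))).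
  now apply HI. }
(* Two claims remain: the integrand is [g] times [D_c f], where [D_c] is factored differently in
   each summand [j], and the double sum of the [I i] reduces to [I 0], the defect of [f] itself. *)
match type of H with is_RInt _ _ _ ?l => replace l with (I O) in H end.
- apply is_RInt_ext with (2 := H). intros t _.
  rewrite (g_sum_kernel a b k d n t); try assumption; try reflexivity.
  2: { intros j Hj. apply Z.le_lt_trans with (1 := n1). apply n_lt; lia. }
  2: { intros j Hj. fold lam. rewrite (Q_eq_0 k lam lam_sq_inj) by exact Hj. tauto. }
  eapply eq_trans; [|apply sum_n_scal_r].
  apply sum_n_ext_loc. intros j Hj.
  rewrite (Hop j t Hj).
  eapply eq_trans; [|apply (scal_assoc (w j) (u j t))].
  apply f_equal. eapply eq_trans; [|apply (sum_n_scal_l (u j t))].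
  apply sum_n_ext. intros i.
  eapply eq_trans; [apply (scal_assoc (coef j i))|].
  eapply eq_trans; [|symmetry; apply (scal_assoc (u j t))].
  apply (f_equal (fun r => scal r _)). apply Rmult_comm.
(* After the exchange, the coefficient of [I i] is that of the interpolated constant 1: it is 1 for
   [i = 0] and 0 otherwise. *)
- transitivity (sum_n (fun i => scal (sum_n (fun j => w j * coef j i) d) (I i)) d).
  + transitivity (sum_n (fun i => scal (match i with O => 1 | S _ => 0 end) (I i)) d).
    * clear. induction d as [|d IH].
      -- rewrite sum_O. symmetry. apply (scal_one (I O)).
      -- rewrite sum_Sn, <- IH, (scal_zero_l _ : scal 0 (I (S d)) = zero).
         symmetry. apply plus_zero_r.
    * apply sum_n_ext_loc. intros i Hi.
      apply (f_equal (fun r => scal r (I i))). symmetry.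
      exact (sum_n_weights_coef k lam lam_sq_inj d i eq_refl Hi).
  + eapply eq_trans.
    { apply sum_n_ext. intros i. symmetry. apply sum_n_scal_r. }
    eapply eq_trans; [apply sum_n_switch|].
    apply sum_n_ext. intros j.
    eapply eq_trans; [|apply (sum_n_scal_l (w j))].
    apply sum_n_ext. intros i. symmetry. apply (scal_assoc (w j)).
Qed.
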